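(* Let $T\ge 1$ and consider the finite horizon $\mathcal T=\{1,\dots,T\}$ with prices $\lambda_1,\dots,\lambda_T$, true opportunity value functions $Q_t$, predicted opportunity value functions $\hat Q_t(\cdot|\lambda_t)$, value errors $\Delta(e_t)=\hat Q_t(e_t|\lambda_t)-Q_t(e_t)$ for $t\in\mathcal T$, and temporal difference errors $\delta(e_t)=\hat Q_t(e_t|\lambda_t)-\bar Q_t(e_t|\lambda_{t+1})$ for $t\in\{1,\dots,T-1\}$. Assume that $\Delta(e_T)=0$ for all $e_T\in[0,E]$, and that prices are non-degenerate: for every $t\in\mathcal T$, $\mathbb P(\lambda_t\in\mathcal S_t)=0$, where $\mathcal S_t$ is the set of constant values taken by $\hat q_t=\partial\hat Q_t/\partial e_t$ on its flat segments. Then $\delta(e_t)=0$ for all $e_t\in[0,E]$ and all $t\in\{1,\dots,T-1\}$ if and only if $\Delta(e_t)=0$ for all $e_t\in[0,E]$ and all $t\in\mathcal T$.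
   Context: Setting. An energy storage unit has power rating $P>0$, capacity $E>0$, charging/discharging efficiency $\eta\in(0,1]$ and marginal discharge cost $C\ge 0$. The real-time price at time $t$ is $\lambda_t\in\mathbb R$ (a random variable; the functions below are defined for its realization). Feasible set. For a state of charge $e_{t-1}\in[0,E]$, $\mathcal E(e_{t-1})$ is the set of triples $(p_t,b_t,e_t)$ (discharge power, charge power, next state of charge) with $0\le p_t\le P$, $0\le b_t\le P$; $p_t=0$ if $\lambda_t<0$; $e_t-e_{t-1}=-p_t/\eta+b_t\eta$; $0\le e_t\le E$. True opportunity value functions. $Q_t:[0,E]\to\mathbb R$, $t\in\mathcal T$, satisfy the backward recursion $$Q_{t-1}(e_{t-1})=\max_{(p_t,b_t,e_t)\in\mathcal E(e_{t-1})}\ \lambda_t(p_t-b_t)-Cp_t+Q_t(e_t),$$ with $Q_T$ a given terminal value function. Each $Q_t$ is non-decreasing, and its derivative $q_t=\partial Q_t/\partial e_t$ is non-increasing (so $Q_t$ is concave). Predicted functions. $\hat Q_t(\cdot|\lambda_t):[0,E]\to\mathbb R$, $t\in\mathcal T$, are predictions of $Q_t$ available once $\lambda_t$ is realized; the marginal $\hat q_t=\partial\hat Q_t/\partial e_t$ is non-increasing and piecewise linear in $e_t$ (so $\hat Q_t$ is concave). Corrected functions. For $t\in\{2,\dots,T\}$, $$\bar Q_{t-1}(e_{t-1}|\lambda_t)=\max_{(p_t,b_t,e_t)\in\mathcal E(e_{t-1})}\ \lambda_t(p_t-b_t)-Cp_t+\hat Q_t(e_t|\lambda_t).$$ Here $\Delta(e_t)$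 and $\delta(e_t)$ denote functions of the state of charge $e_t\in[0,E]$ at time $t$ (thus one function for each $t$). *)

(* Defs.v *)
From HB Require Import structures.
From mathcomp Require Import all_boot all_order all_algebra.
From mathcomp Require Import all_classical all_reals all_analysis.

Set Implicit Arguments.
Unset Strict Implicit.
Unset Printing Implicit Defensive.

Import Order.TTheory GRing.Theory Num.Theory.
Import numFieldNormedType.Exports.

Local Open Scope classical_set_scope.
Local Open Scope ring_scope.

Record storage (R : realType) := Storage {
  rating : R;
  capacity : R;
  efficiency : R;
  discharge_cost : R;
  rating_gt0 : 0 < rating;
  capacity_gt0 : 0 < capacity;
  efficiency_gt0 : 0 < efficiency;
  efficiency_le1 : efficiency <= 1;
  discharge_cost_ge0 : 0 <= discharge_cost }.

(* State-of-charge functions are total functions R -> R of which only the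
   values on [0, E] are meaningful.  The triples are (p, b, e'): discharge
   power, charge power, next state of charge. *)
Definition feasible (R : realType) (s : storage R) (l e : R) :
    set (R * R * R) :=
  [set x | let: (p, b, e') := x in
     [/\ 0 <= p <= rating s, 0 <= b <= rating s, (l < 0 -> p = 0),
         e' - e = - p / efficiency s + b * efficiency s &
         0 <= e' <= capacity s]].

Definition objective (R : realType) (s : storage R) (l : R) (F : R -> R)
    (x : R * R * R) : R :=
  let: (p, b, e') := x in l * (p - b) - discharge_cost s * p + F e'.

(* The default value 0 is used only when A has no greatest element; see
   bellman_max below for the maxima considered here. *)
Definition maximum (R : realType) (A : set R) : R := xget 0 (A `&` ubound A).

Definition bellman (R : realType) (s : storage R) (l : R) (F : R -> R)
    (e : R) : R :=
  maximum (objective s l F @` feasible s l e).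

(* Concave functions may have kinks, and the Bellman recursion creates some
   even from smooth terminal values, so the derivative is only required to
   exist outside of a countable set; it is non-increasing where it exists.
   A function that is differentiable on all of [0, E] is the case D = set0. *)
Definition nonincreasing_marginal (R : realType) (E : R) (F : R -> R) : Prop :=
  [/\ {within `[0, E], continuous F},
      exists2 D : set R, countable D &
        forall x : R, 0 < x < E -> ~ D x -> derivable F x 1 &
      forall x y : R, 0 < x -> x <= y -> y < E ->
        derivable F x 1 -> derivable F y 1 -> 'D_1 F y <= 'D_1 F x].

(* The derivative may jump at the breakpoints x i. *)
Definition piecewise_linear_marginal (R : realType) (E : R) (F : R -> R) :
    Prop :=
  exists (n : nat) (x a b : nat -> R),
    [/\ x 0%N = 0, x n = E &
      forall i, (i < n)%N -> x i < x i.+1 /\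
        forall e : R, x i < e < x i.+1 -> is_derive e 1 F (a i * e + b i)].

Definition flat_values (R : realType) (E : R) (F : R -> R) : set R :=
  [set c | exists a b : R, [/\ 0 <= a, a < b, b <= E &
     forall e : R, a < e < b -> is_derive e 1 F c]].

(* Qhat t l e is the prediction at time t for the price l, evaluated at e;
   corrected s Qhat t l is the corrected function at time t for the price l
   of time t + 1. *)
Definition corrected (R : realType) (s : storage R) (Qhat : nat -> R -> R -> R)
    (t : nat) (l e : R) : R :=
  bellman s l (Qhat t.+1 l) e.

Definition value_error (R : realType) (Qhat : nat -> R -> R -> R)
    (Q : nat -> R -> R) (lam : nat -> R) (t : nat) (e : R) : R :=
  Qhat t (lam t) e - Q t e.

Definition td_error (R : realType) (s : storage R) (Qhat : nat -> R -> R -> R)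
    (lam : nat -> R) (t : nat) (e : R) : R :=
  Qhat t (lam t) e - corrected s Qhat t (lam t.+1) e.

Lemma bellman_max (R : realType) (s : storage R) (l : R) (F : R -> R) (e : R) :
  {within `[0, capacity s], continuous F} -> 0 <= e <= capacity s ->
  (exists2 x, feasible s l e x & objective s l F x = bellman s l F e) /\
  (forall x, feasible s l e x -> objective s l F x <= bellman s l F e).
Proof.
move=> cF eE.
pose A : set R := objective s l F @` feasible s l e.
suff [y Ay] : exists y, (A `&` ubound A) y.
  have [[x fx ox] ub] : (A `&` ubound A) (bellman s l F e).
    by apply: xgetPex; exists y.
  by split; [exists x | move=> z fz; apply: ub; exists z].
pose P' : R := if l < 0 then 0 else rating s.
pose h (x : R * R) : R := e + (- x.1 / efficiency s + x.2 * efficiency s).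
pose g (x : R * R) : R :=
  l * (x.1 - x.2) - discharge_cost s * x.1 + F (h x).
pose K := (`[0, P'] `*` `[0, rating s]) `&` h @^-1` `[0, capacity s].
have P'P : 0 <= P' <= rating s.
  by rewrite /P'; case: ifP => _; rewrite ?lexx ?(ltW (rating_gt0 s)).
have fK p b e' : feasible s l e (p, b, e') -> K (p, b) /\ e' = h (p, b).
  move=> [pP bP lp ee e'E].
  have -> : e' = h (p, b) by rewrite /h /= -ee addrC subrK.
  split=> //; split; first split => /=; rewrite ?in_itv//=.
    by rewrite /P'; case: ifP => // /lp ->; rewrite lexx.
  by rewrite /h /= -ee addrC subrK.
have Kf x : K x -> feasible s l e (x.1, x.2, h x).
  move=> [[/=]]; rewrite !in_itv/= => /andP[p0 pP'] bP hE; split => //.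
  - by rewrite p0 (le_trans pP')//; case/andP: P'P.
  - by move=> l0; apply/le_anti; rewrite p0 andbT; move: pP'; rewrite /P' l0.
  - by rewrite /h addrC addKr.
have ch : continuous h.
  move=> x; apply: cvgD; first exact: cvg_cst.
  apply: cvgD; apply: cvgMr_tmp; last exact: cvg_snd.
  by apply: cvgN; exact: cvg_fst.
have cK : compact K.
  apply: compact_closedI; first by apply: compact_setX; exact: segment_compact.
  by apply: preimage_closed => [x _|]; [exact: ch|exact: itv_closed].
have cg : {within K, continuous g}.
  apply/subspace_continuousP => x Kx; apply: cvgD.
    apply: cvg_within_filter; apply: cvgB; apply: cvgMl_tmp.
      by apply: cvgB; [exact: cvg_fst|exact: cvg_snd].
    exact: cvg_fst.
  have hx : 0 <= h x <= capacity s by case: Kx => _ /=; rewrite in_itv.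
  move/subspace_continuousP: cF => /(_ (h x)) cFx.
  apply: (cvg_comp h F _ (cFx _)); last by rewrite /= in_itv.
  move=> U UhE; have H := ch x _ UhE.
  apply: (@filterS _ (nbhs x) _ _ _ _ H) => y /= Hy Ky.
  by apply: Hy; case: Ky.
have K0 : K !=set0.
  exists (0, 0); split.
    by split; rewrite /= in_itv/= lexx//=; [case/andP: P'P|exact/ltW/rating_gt0].
  by rewrite /= in_itv/= /h /= oppr0 !mul0r !addr0.
have [c cK' cmax] := compact_EVT_max K0 cK cg.
exists (g c); split.
  by exists (c.1, c.2, h c); [apply: Kf; exact: set_mem|].
move=> _ [[[p b] e'] /fK[Kpb ->] <-].
by apply: (cmax (p, b)); exact/mem_set.
Qed.

(* Main.v *)
(** The Bellman operator only sees its argument on [0, E].  Hence, wherever the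
    value error vanishes at time t + 1, the corrected function at time t is the
    true one, so that the temporal difference error and the value error at time
    t coincide; backward induction from the terminal time concludes. *)

Require Import Defs.
From HB Require Import structures.
From mathcomp Require Import all_boot all_order all_algebra.
From mathcomp Require Import all_classical all_reals all_analysis.
Import Order.TTheory GRing.Theory Num.Theory.
Import numFieldNormedType.Exports.
Local Open Scope classical_set_scope.
Local Open Scope ring_scope.

(** Feasibility confines the next state of charge to [0, E], so [F] and [G] give the same set of
    objective values, hence the same [maximum]. *)
Lemma eq_bellman (R : realType) (s : storage R) (l e : R) (F G : R -> R) :
  (forall x, 0 <= x <= capacity s -> F x = G x) ->
  bellman s l F e = bellman s l G e.
Proof.
move=> FG; rewrite /bellman; congr maximum.
by apply: eq_imagel => -[[p b] x] [_ _ _ _ xE] /=; rewrite FG.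
Qed.

Lemma td_error_value_error (R : realType) (s : storage R)
    (Qhat : nat -> R -> R -> R) (Q : nat -> R -> R) (lam : nat -> R)
    (t : nat) (e : R) :
  Q t e = bellman s (lam t.+1) (Q t.+1) e ->
  (forall x, 0 <= x <= capacity s -> value_error Qhat Q lam t.+1 x = 0) ->
  td_error s Qhat lam t e = value_error Qhat Q lam t e.
Proof.
move=> Qt err0; rewrite /td_error /value_error Qt; congr (_ - _).
by apply: eq_bellman => x /err0 /subr0_eq.
Qed.

Theorem proposition1 (R : realType) (d : measure_display)
    (Omega : measurableType d) (Pr : probability Omega R)
    (s : storage R) (T : nat) (T_ge1 : (1 <= T)%N)
    (lam : nat -> {RV Pr >-> R}) (Qhat : nat -> R -> R -> R)
    (Qhat_marginal : forall (t : nat) (w : Omega), (1 <= t <= T)%N ->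
       nonincreasing_marginal (capacity s) (Qhat t (lam t w)) /\
       piecewise_linear_marginal (capacity s) (Qhat t (lam t w)))
    (nondegenerate : forall t : nat, (1 <= t <= T)%N ->
       Pr.-negligible [set w : Omega |
         flat_values (capacity s) (Qhat t (lam t w)) (lam t w)])
    (* a realization of the prices, and the value functions along it *)
    (w : Omega) (Q : nat -> R -> R)
    (Q_bellman : forall (t : nat) (e : R), (1 < t <= T)%N ->
       0 <= e <= capacity s -> Q t.-1 e = bellman s (lam t w) (Q t) e)
    (Q_nondecreasing : forall (t : nat) (x y : R), (1 <= t <= T)%N ->
       0 <= x -> x <= y -> y <= capacity s -> Q t x <= Q t y)
    (Q_marginal : forall t : nat, (1 <= t <= T)%N ->
       nonincreasing_marginal (capacity s) (Q t))
    (terminal : forall e : R, 0 <= e <= capacity s ->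
       value_error Qhat Q (fun u => lam u w) T e = 0) :
  (forall (t : nat) (e : R), (1 <= t < T)%N -> 0 <= e <= capacity s ->
     td_error s Qhat (fun u => lam u w) t e = 0) <->
  (forall (t : nat) (e : R), (1 <= t <= T)%N -> 0 <= e <= capacity s ->
     value_error Qhat Q (fun u => lam u w) t e = 0).
Proof.
have tdE t e : (1 <= t < T)%N -> 0 <= e <= capacity s ->
    (forall x, 0 <= x <= capacity s ->
       value_error Qhat Q (fun u => lam u w) t.+1 x = 0) ->
    td_error s Qhat (fun u => lam u w) t e =
    value_error Qhat Q (fun u => lam u w) t e.
  move=> /andP[t1 tT] eE; apply: td_error_value_error.
  (* The recursion is indexed by the later time: at [t.+1] its range is exactly [1 <= t < T]. *)
  by apply: (Q_bellman t.+1); rewrite // ltnS t1.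
split=> [td0|err0] t e; last first.
  move=> /andP[t1 tT] eE; rewrite tdE ?t1//; first by rewrite err0// t1 ltnW.
  by move=> x; apply: err0; rewrite tT.
(* Backward induction on [t] becomes ordinary induction on [k], the number of periods left before
   [T]. *)
move=> /andP[t1 tT]; have [k kE] : exists k, (t + k)%N = T.
  by exists (T - t)%N; rewrite subnKC.
(* [e] is generalized because the step at one state of charge needs the error at [t.+1] to vanish on
   all of [0, E]. *)
elim: k t t1 tT kE e => [|k IHk] t t1 tT kE e eE.
  by move: kE; rewrite addn0 => ->; exact: terminal.
have tltT : (t < T)%N by rewrite -kE addnS ltnS leq_addr.
(* The side condition of [tdE], a zero value error at [t.+1], is left to the induction
   hypothesis. *)
rewrite -tdE ?t1//; first by apply: td0; rewrite ?t1.
by apply: IHk; rewrite // addSnnS.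
Qed.
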